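(* Consider the semi-implicit SAV/BDF scheme for the unknowns $(\phi^{n+1},\mu^{n+1},r^{n+1})$, with time step $\Delta t$: $$\frac{3\phi^{n+1}-4\phi^n+\phi^{n-1}}{2\Delta t}=\mathcal G\mu^{n+1},$$ $$\mu^{n+1}=\mathcal L\phi^{n+1}+\frac{r^{n+1}}{\sqrt{\mathcal E_1[\bar\phi^{n+1}]}}\,U[\bar\phi^{n+1}],$$ $$3r^{n+1}-4r^n+r^{n-1}=\int_\Omega\frac{U[\bar\phi^{n+1}]}{2\sqrt{\mathcal E_1[\bar\phi^{n+1}]}}(3\phi^{n+1}-4\phi^n+\phi^{n-1})\,d\boldsymbol x,$$ where $\bar\phi^{n+1}$ can be any explicit approximation of $\phi(t^{n+1})$ with an error of $O(\Delta t^2)$. This scheme is second-order accurate, unconditionally energy stable in the sense that $$\frac1{\Delta t}\Big\{\tilde{\mathcal E}[(\phi^{n+1},r^{n+1}),(\phi^n,r^n)]-\tilde{\mathcal E}[(\phi^n,r^n),(\phi^{n-1},r^{n-1})]\Big\}$$ $$+\frac1{\Delta t}\Big\{\tfrac14\big(\phi^{n+1}-2\phi^n+\phi^{n-1},\mathcal L(\phi^{n+1}-2\phi^n+\phi^{n-1})\big)+\tfrac12(r^{n+1}-2r^n+r^{n-1})^2\Big\}=(\mu^{n+1},\mathcal G\mu^{n+1}),$$ where the modified discrete energy is defined as $$\tilde{\mathcal E}[(\phi^{n+1},r^{n+1}),(\phi^n,r^n)]=\tfrac14\Big((\phi^{n+1},\mathcal L\phi^{n+1})+\big(2\phi^{n+1}-\phi^n,\mathcal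 L(2\phi^{n+1}-\phi^n)\big)\Big)+\tfrac12\big((r^{n+1})^2+(2r^{n+1}-r^n)^2\big),$$ and one can obtain $(\phi^{n+1},\mu^{n+1},r^{n+1})$ by solving two linear equations with constant coefficients of the form $$(I-\Delta t\,\mathcal G\mathcal L)\bar x=\bar b.$$
   Context: $\Omega$ is the spatial domain and $(\phi,\psi)=\int_\Omega\phi\psi\,d\boldsymbol x$. Boundary conditions (e.g. periodic or homogeneous Neumann) are such that all boundary terms vanish when integrating by parts. $\mathcal G$ is a symmetric non-positive linear operator independent of $\phi$, and $\mathcal L$ is a symmetric non-negative linear operator independent of $\phi$. The free energy is $\mathcal E[\phi]=\frac12(\phi,\mathcal L\phi)+\mathcal E_1[\phi]$, where $\mathcal E_1$ is nonlinear, involves only lower-order derivatives than $\mathcal L$, and satisfies $\mathcal E_1[\phi]\ge C_0>0$ (without loss of generality, once $\mathcal E_1$ is bounded from below, by adding a constant). $U[\phi]=\delta\mathcal E_1/\delta\phi$ is the variational derivative of $\mathcal E_1$. The gradient flow is $\partial_t\phi=\mathcal G\,\delta\mathcal E/\delta\phi$. With the scalar auxiliary variable (SAV) $r(t)=\sqrt{\mathcal E_1[\phi(t)]}$, it is rewritten as $$\phi_t=\mathcal G\mu,\qquad \mu=\mathcal L\phi+\frac{r}{\sqrt{\mathcal E_1[\phi]}}U[\phi],\qquad r_t=\frac1{2\sqrt{\mathcal E_1[\phi]}}\int_\Omega U[\phi]\phi_t\,d\boldsymbol x,$$ and the scheme discretizes this system in time by the second-order backward differentiation formula (BDF). Here $\phi^n$,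 $\mu^n$, $r^n$ denote the approximations at time $t^n=n\Delta t$; $\phi^n,\phi^{n-1},r^n,r^{n-1}$ are known when computing step $n+1$, and $I$ is the identity operator.
   Formalization: The two linear equations are stated with operator I − (2/3)Δt GL, which elimination in the BDF2 scheme actually gives, instead of the printed I − Δt GL; ''second-order accurate'' is read as O(Δt²) truncation error for smooth solutions. *)

(* Defs.v *)
(* The spatial domain is a measurable space Omega carrying a measure vol (for
   an open subset of R^d: the Lebesgue measure), and fields are functions
   Omega -> R in L^2.  G and L are unbounded operators: each has a domain,
   where the boundary conditions are recorded, and is symmetric there.
   Equations between fields hold almost everywhere. *)
From mathcomp Require Import all_boot all_order all_algebra.
From mathcomp Require Import all_classical all_reals all_analysis.

Set Implicit Arguments.
Unset Strict Implicit.
Unset Printing Implicit Defensive.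

Import Order.TTheory GRing.Theory Num.Theory.
Import numFieldNormedType.Exports.

Local Open Scope classical_set_scope.
Local Open Scope ring_scope.

Section Fields.
Context {R : realType} {d : measure_display} {Omega : measurableType d}.
Variable vol : {measure set Omega -> \bar R}.

Local Notation field := (Omega -> R).

Definition L2 : set field := [set f | f \in Lfun vol 2%:E].

Definition inner (f g : field) : R := \int[vol]_x (f x * g x).

Definition l2norm (f : field) : R := Num.sqrt (inner f f).

Definition l2_subspace (D : set field) : Prop :=
  [/\ D `<=` L2, D 0 &
      forall (a : R) (u v : field), D u -> D v -> D (a *: u + v)].

Definition l2_dense (D : set field) : Prop :=
  forall f : field, L2 f -> forall e : R, 0 < e ->
    exists2 g : field, D g & l2norm (f - g) < e.

(* Linearity is only required on the domain D; values outside D are junk. *)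
Record symmetric_operator (D : set field) (A : field -> field) : Prop := {
  symop_subspace : l2_subspace D;
  symop_dense : l2_dense D;
  symop_L2 : forall u : field, D u -> L2 (A u);
  symop_linear : forall (a : R) (u v : field),
    D u -> D v -> A (a *: u + v) = a *: A u + A v;
  symop_sym : forall u v : field, D u -> D v -> inner (A u) v = inner u (A v)
}.

Definition nonnegative_on (D : set field) (A : field -> field) : Prop :=
  forall u : field, D u -> 0 <= inner u (A u).

Definition nonpositive_on (D : set field) (A : field -> field) : Prop :=
  forall u : field, D u -> inner u (A u) <= 0.

(* U = delta E / delta phi, i.e. d/de E[v + e w] = (U[v], w) at e = 0. *)
Definition variational_derivative
    (D : set field) (E : field -> R) (U : field -> field) : Prop :=
  (forall v : field, D v -> L2 (U v)) /\
  (forall v w : field, D v -> D w ->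
     is_derive (0 : R) (1 : R) (fun e : R => E (v + e *: w)) (inner (U v) w)).

Definition bdf2 (V : lmodType R) (u0 u1 u2 : V) : V :=
  3%:R *: u2 - 4%:R *: u1 + u0.

Section Scheme.
Variables (domG domL : set field) (G L : field -> field).
Variables (E1 : field -> R) (U : field -> field).

(* Indices 0, 1, 2 stand for the time levels n-1, n, n+1. *)
Definition sav_bdf_step (dt : R) (phibar phi0 phi1 : field) (r0 r1 : R)
    (phi2 mu2 : field) (r2 : R) : Prop :=
  [/\ domL phi2, domG mu2,
      (2%:R * dt)^-1 *: bdf2 phi0 phi1 phi2 = G mu2 %[ae vol],
      mu2 = L phi2 + (r2 / Num.sqrt (E1 phibar)) *: U phibar %[ae vol] &
      3%:R * r2 - 4%:R * r1 + r0 =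
        inner ((2%:R * Num.sqrt (E1 phibar))^-1 *: U phibar)
              (bdf2 phi0 phi1 phi2)].

Definition modified_energy (phi1 : field) (r1 : R) (phi0 : field) (r0 : R) : R :=
  4%:R^-1 * (inner phi1 (L phi1) +
             inner (2%:R *: phi1 - phi0) (L (2%:R *: phi1 - phi0))) +
  2%:R^-1 * (r1 ^+ 2 + (2%:R * r1 - r0) ^+ 2).

(* u solves (I - lambda G L) u = b. *)
Definition solves_linear (lambda : R) (b u : field) : Prop :=
  [/\ domL u, domG (L u) & u - lambda *: G (L u) = b %[ae vol]].

(* Eliminating mu2 and r2 from the scheme gives, with lambda = 2 dt / 3,
   beta = U[phibar] / sqrt(E1[phibar]), phistar = (4 phi1 - phi0) / 3 and
   rstar = (4 r1 - r0) / 3,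
     (I - lambda G L) phi2 - lambda / 2 (beta, phi2) G beta = sav_rhs,
     r2 = rstar + (beta, phi2 - phistar) / 2.
   Hence phi2 = xi1 + lambda / 2 (beta, phi2) xi2, where xi1 and xi2 solve
   (I - lambda G L) xi = b for b = sav_rhs and b = G beta, and pairing with
   beta determines (beta, phi2). *)
Definition sav_lambda (dt : R) : R := 2%:R / 3%:R * dt.

Definition sav_beta (phibar : field) : field :=
  (Num.sqrt (E1 phibar))^-1 *: U phibar.

Definition sav_phistar (phi0 phi1 : field) : field :=
  3%:R^-1 *: (4%:R *: phi1 - phi0).

Definition sav_rstar (r0 r1 : R) : R := (4%:R * r1 - r0) / 3%:R.

Definition sav_rhs (dt : R) (phibar phi0 phi1 : field) (r0 r1 : R) : field :=
  sav_phistar phi0 phi1 +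
  (sav_lambda dt * (sav_rstar r0 r1 -
     inner (sav_beta phibar) (sav_phistar phi0 phi1) / 2%:R))
    *: G (sav_beta phibar).

Definition sav_pairing (dt : R) (phibar xi1 xi2 : field) : R :=
  inner (sav_beta phibar) xi1 /
  (1 - sav_lambda dt / 2%:R * inner (sav_beta phibar) xi2).

Definition sav_phi (dt : R) (phibar xi1 xi2 : field) : field :=
  xi1 + (sav_lambda dt / 2%:R * sav_pairing dt phibar xi1 xi2) *: xi2.

Definition sav_r (dt : R) (phibar phi0 phi1 : field) (r0 r1 : R)
    (xi1 xi2 : field) : R :=
  sav_rstar r0 r1 +
  (sav_pairing dt phibar xi1 xi2 -
   inner (sav_beta phibar) (sav_phistar phi0 phi1)) / 2%:R.

Definition sav_mu (dt : R) (phibar phi0 phi1 : field) (r0 r1 : R)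
    (xi1 xi2 : field) : field :=
  L (sav_phi dt phibar xi1 xi2) +
  sav_r dt phibar phi0 phi1 r0 r1 xi1 xi2 *: sav_beta phibar.

(* f' is the derivative of f on [0, T] for the seminorm nrm (one-sided at the
   endpoints). *)
Definition time_derivative (V : lmodType R) (nrm : V -> R) (T : R)
    (f f' : R -> V) : Prop :=
  forall t : R, 0 <= t <= T ->
    nrm ((s - t)^-1 *: (f s - f t) - f' t) @[s --> within `[0, T] t^']
      --> (0 : R).

Definition twice_differentiable (V : lmodType R) (S : set V) (nrm : V -> R)
    (T : R) (f : R -> V) : Prop :=
  exists f1 f2 : R -> V,
    [/\ forall t : R, 0 <= t <= T -> S (f1 t) /\ S (f2 t),
        time_derivative nrm T f f1,
        time_derivative nrm T f1 f2 &
        exists M : R, forall t : R, 0 <= t <= T -> nrm (f2 t) <= M].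

(* Solution on [0, T] of the SAV form of the gradient flow; phit and rt are
   the time derivatives of phi and r. *)
Record sav_solution (T : R) (phi phit mu : R -> field) (r rt : R -> R) : Prop := {
  sav_sol_phi : forall t : R, 0 <= t <= T -> domL (phi t);
  sav_sol_phit : forall t : R, 0 <= t <= T -> L2 (phit t);
  sav_sol_mu : forall t : R, 0 <= t <= T -> domG (mu t);
  sav_sol_dphi : time_derivative l2norm T phi phit;
  sav_sol_dr : @time_derivative R^o Num.norm T r rt;
  sav_sol_eq_phi : forall t : R, 0 <= t <= T -> phit t = G (mu t) %[ae vol];
  sav_sol_eq_mu : forall t : R, 0 <= t <= T ->
    mu t = L (phi t) + (r t / Num.sqrt (E1 (phi t))) *: U (phi t) %[ae vol];
  sav_sol_eq_r : forall t : R, 0 <= t <= T ->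
    rt t = (2%:R * Num.sqrt (E1 (phi t)))^-1 * inner (U (phi t)) (phit t);
  sav_sol_r : forall t : R, 0 <= t <= T -> r t = Num.sqrt (E1 (phi t))
}.

(* phi and r are three times differentiable in time, with bounded third
   derivatives. *)
Definition smooth_in_time (T : R) (phit : R -> field) (rt : R -> R) : Prop :=
  twice_differentiable L2 l2norm T phit /\
  @twice_differentiable R^o setT Num.norm T rt.

(* N is a norm on the domain of L, at least as strong as the L^2 norm. *)
Definition norm_over_l2 (N : field -> R) : Prop :=
  [/\ forall (a : R) (v : field), domL v -> N (a *: v) = `|a| * N v,
      forall u v : field, domL u -> domL v -> N (u + v) <= N u + N v &
      exists c : R, forall v : field, domL v -> l2norm v <= c * N v].

Definition lipschitz_on_bounded_sets (N : field -> R) : Prop :=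
  forall M : R, exists K : R, forall u v : field,
    domL u -> domL v -> N u <= M -> N v <= M ->
    l2norm (U u - U v) <= K * N (u - v).

(* phibar dt n approximates phi at time (n + 1) dt, with an O(dt^2) error
   that is uniform in n. *)
Definition second_order_approximation (N : field -> R) (T : R)
    (phi : R -> field) (phibar : R -> nat -> field) : Prop :=
  exists C delta : R, 0 < delta /\
    forall (dt : R) (n : nat), 0 < dt < delta -> (0 < n)%N -> n.+1%:R * dt <= T ->
      domL (phibar dt n) /\
      N (phibar dt n - phi (n.+1%:R * dt)) <= C * dt ^+ 2.

(* Local truncation errors: the residuals left in the three equations of the
   scheme (the last one also divided by 2 dt) by the exact solution. *)
Definition truncation_phi (dt : R) (phi mu : R -> field) (n : nat) : field :=
  (2%:R * dt)^-1 *: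
    bdf2 (phi (n.-1%:R * dt)) (phi (n%:R * dt)) (phi (n.+1%:R * dt)) -
  G (mu (n.+1%:R * dt)).

Definition truncation_mu (dt : R) (phi mu : R -> field) (r : R -> R)
    (phibar : field) (n : nat) : field :=
  mu (n.+1%:R * dt) -
  (L (phi (n.+1%:R * dt)) +
   (r (n.+1%:R * dt) / Num.sqrt (E1 phibar)) *: U phibar).

Definition truncation_r (dt : R) (phi : R -> field) (r : R -> R)
    (phibar : field) (n : nat) : R :=
  (2%:R * dt)^-1 *
  (3%:R * r (n.+1%:R * dt) - 4%:R * r (n%:R * dt) + r (n.-1%:R * dt) -
   inner ((2%:R * Num.sqrt (E1 phibar))^-1 *: U phibar)
     (bdf2 (phi (n.-1%:R * dt)) (phi (n%:R * dt)) (phi (n.+1%:R * dt)))).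

Definition second_order_accurate (T : R) (phi mu : R -> field) (r : R -> R)
    (phibar : R -> nat -> field) : Prop :=
  exists C delta : R, 0 < delta /\
    forall (dt : R) (n : nat), 0 < dt < delta -> (0 < n)%N -> n.+1%:R * dt <= T ->
      [/\ l2norm (truncation_phi dt phi mu n) <= C * dt ^+ 2,
          l2norm (truncation_mu dt phi mu r (phibar dt n) n) <= C * dt ^+ 2 &
          `|truncation_r dt phi r (phibar dt n) n| <= C * dt ^+ 2].

End Scheme.
End Fields.

(* Main.v *)
(* Energy law: pair the first equation with mu^{n+1}, and use
     2 a (3 a - 4 b + c) = a^2 + (2 a - b)^2 - b^2 - (2 b - c)^2 + (a - 2 b + c)^2
   for r and, polarized, for the form (., L .).

   Linear equations: eliminating mu and r leaves one scalar unknown, the pairing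
   (beta, phi).  Its equation is solvable because xi2 = G w with
   w = beta + lambda L xi2, so that (beta, xi2) = (w, G w) - lambda (xi2, L xi2) <= 0.
   The difference (p, m, r) of two solutions satisfies
   lambda (m, G m) = (m, p) = (p, L p) + 2 r^2, hence both sides vanish.  As the
   domains are dense, (m, G m) = 0 forces G m = 0 and p = 0 forces L p = 0.

   Accuracy: Taylor expansion of phi and r for the BDF quotients.  The Lipschitz
   bound on U, integrated along segments, makes E1 and then
   beta = U / sqrt(E1) Lipschitz on bounded sets, so replacing phi by phibar
   costs O(dt^2). *)
Require Import Defs.
From mathcomp Require Import all_boot all_order all_algebra.
From mathcomp Require Import all_classical all_reals all_analysis.
From mathcomp Require Import measurable_realfun ring lra.

Set Implicit Arguments.
Unset Strict Implicit.
Unset Printing Implicit Defensive.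

Import Order.TTheory GRing.Theory Num.Theory.
Import numFieldNormedType.Exports.

Local Open Scope classical_set_scope.
Local Open Scope ring_scope.

Section L2_space.
Context {R : realType} {d : measure_display} {Omega : measurableType d}.
Variable vol : {measure set Omega -> \bar R}.
Local Notation field := (Omega -> R).
Local Notation L2 := (L2 vol).
Local Notation inner := (inner vol).
Local Notation l2norm := (l2norm vol).
Implicit Types (f g h u v w : field) (a : R).

Lemma lee1_2 : (1%E <= 2%:E :> \bar R)%E.
Proof. by rewrite lee_fin ler1n. Qed.

Lemma L2_lin a f g : L2 f -> L2 g -> L2 (a *: f + g).
Proof.
move=> f2 g2; have /= [_ cl] := Lfun_submod_closed vol lee1_2.
exact: cl.
Qed.

Lemma L2_0 : L2 0.
Proof. by have /= [] := Lfun_submod_closed vol lee1_2. Qed.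

Lemma L2Z a f : L2 f -> L2 (a *: f).
Proof. by move=> f2; rewrite -[_ *: _]addr0; apply: L2_lin => //; exact: L2_0. Qed.

Lemma L2D f g : L2 f -> L2 g -> L2 (f + g).
Proof. by move=> f2 g2; rewrite -[f]scale1r; exact: L2_lin. Qed.

Lemma L2N f : L2 f -> L2 (- f).
Proof. by move=> f2; rewrite -scaleN1r; exact: L2Z. Qed.

Lemma L2B f g : L2 f -> L2 g -> L2 (f - g).
Proof. by move=> f2 g2; apply: L2D => //; exact: L2N. Qed.

Lemma L2_measurable f : L2 f -> measurable_fun setT f.
Proof. by rewrite /Defs.L2 /= => /sub_Lfun_mfun; rewrite inE. Qed.

Lemma L2_mul_integrable f g : L2 f -> L2 g ->
  vol.-integrable setT (EFin \o (fun x => f x * g x)).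
Proof. by move=> f2 g2; apply/Lfun1_integrable; exact: Lfun2_mul_Lfun1. Qed.

Lemma innerC f g : inner f g = inner g f.
Proof. by apply: eq_Rintegral => x _; rewrite mulrC. Qed.

Lemma inner_linl a f g h : L2 f -> L2 g -> L2 h ->
  inner (a *: f + g) h = a * inner f h + inner g h.
Proof.
move=> f2 g2 h2; rewrite /Defs.inner.
rewrite -RintegralZl//; last exact: L2_mul_integrable.
rewrite -RintegralD//; last 2 first.
- have := L2_mul_integrable (L2Z a f2) h2. congr integrable;
  by apply/funext => x /=; rewrite mulrA.
- exact: L2_mul_integrable.
by apply: eq_Rintegral => x _; rewrite mulrA -mulrDl.
Qed.

Lemma inner0l h : inner 0 h = 0.
Proof.
have -> : inner 0 h = \int[vol]_(x in setT) (0 : R).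
  by apply: eq_Rintegral => x _; rewrite mul0r.
by rewrite Rintegral_cst// mul0r.
Qed.

Lemma innerZl a f h : L2 f -> L2 h -> inner (a *: f) h = a * inner f h.
Proof.
move=> f2 h2; rewrite -[a *: f]addr0 inner_linl//; last exact: L2_0.
by rewrite inner0l addr0.
Qed.

Lemma innerDl f g h : L2 f -> L2 g -> L2 h ->
  inner (f + g) h = inner f h + inner g h.
Proof. by move=> *; rewrite -[f]scale1r inner_linl// mul1r scale1r. Qed.

Lemma innerNl f h : L2 f -> L2 h -> inner (- f) h = - inner f h.
Proof. by move=> *; rewrite -scaleN1r innerZl// mulN1r. Qed.

Lemma innerBl f g h : L2 f -> L2 g -> L2 h ->
  inner (f - g) h = inner f h - inner g h.
Proof. by move=> f2 g2 h2; rewrite innerDl ?innerNl//; exact: L2N. Qed.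

Lemma innerZr a f h : L2 f -> L2 h -> inner h (a *: f) = a * inner h f.
Proof. by move=> *; rewrite innerC innerZl// innerC. Qed.

Lemma innerDr f g h : L2 f -> L2 g -> L2 h ->
  inner h (f + g) = inner h f + inner h g.
Proof. by move=> *; rewrite innerC innerDl// ![inner h _]innerC. Qed.

Lemma innerBr f g h : L2 f -> L2 g -> L2 h ->
  inner h (f - g) = inner h f - inner h g.
Proof. by move=> *; rewrite innerC innerBl// ![inner h _]innerC. Qed.

Lemma inner_ge0 f : 0 <= inner f f.
Proof. by apply: Rintegral_ge0 => x _; rewrite -expr2 sqr_ge0. Qed.

Lemma sqr_l2norm f : l2norm f ^+ 2 = inner f f.
Proof. by rewrite sqr_sqrtr ?inner_ge0. Qed.

Lemma l2norm_ge0 f : 0 <= l2norm f.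
Proof. exact: sqrtr_ge0. Qed.

Lemma inner_ae f f' g g' : L2 f -> L2 f' -> L2 g -> L2 g' ->
  f = f' %[ae vol] -> g = g' %[ae vol] -> inner f g = inner f' g'.
Proof.
move=> f2 f2' g2 g2' ff' gg'; rewrite /Defs.inner /Rintegral; congr fine.
apply: ae_eq_integral => //.
- by apply/measurable_EFinP; apply: measurable_funM; exact: L2_measurable.
- by apply/measurable_EFinP; apply: measurable_funM; exact: L2_measurable.
by apply: filterS2 ff' gg' => x /(_ I) fx /(_ I) gx _ /=; rewrite fx gx.
Qed.

Lemma l2norm_ae f f' : L2 f -> L2 f' -> f = f' %[ae vol] -> l2norm f = l2norm f'.
Proof. by move=> f2 f2' ff'; rewrite /Defs.l2norm (inner_ae f2 f2' f2 f2'). Qed.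

Lemma inner_eq0 f : L2 f -> inner f f = 0 -> f = 0 %[ae vol].
Proof.
move=> f2 f0.
have intf := L2_mul_integrable f2 f2.
set F := EFin \o _ in intf.
have F0 : (\int[vol]_x `|F x| = 0)%E.
  have -> : (\int[vol]_x `|F x| = \int[vol]_x F x)%E.
    by apply: eq_integral => x _; rewrite /F /= ger0_norm// -expr2 sqr_ge0.
  by rewrite -[LHS]fineK ?integrable_fin_num//; congr EFin.
have [mF _] := integrableP _ _ _ intf.
have [/(_ F0) + _] := ae_eq_integral_abs vol measurableT mF.
apply: filterS => x /(_ I) /= [] /eqP.
by rewrite mulf_eq0 orbb => /eqP fx _.
Qed.

Lemma l2norm_eq0 f : L2 f -> l2norm f = 0 -> f = 0 %[ae vol].
Proof. by move=> f2 f0; apply: inner_eq0 => //; rewrite -sqr_l2norm f0 expr0n. Qed.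

Lemma discriminant_le (a b c : R) :
  (forall t, 0 <= t ^+ 2 * a + 2 * t * b + c) -> b ^+ 2 <= a * c.
Proof.
move=> H; pose p := Poly [:: c; 2 * b; a].
have : (2 * b) ^+ 2 - 4 * a * c <= 0.
  have -> : 2 * b = p`_1 by rewrite !coefE.
  have -> : a = p`_2 by rewrite !coefE.
  have -> : c = p`_0 by rewrite !coefE.
  rewrite deg_le2_poly_ge0 ?size_Poly// => t.
  by rewrite horner_Poly/=; have := H t; lra.
by lra.
Qed.

Lemma cauchy_schwarz f g : L2 f -> L2 g -> `|inner f g| <= l2norm f * l2norm g.
Proof.
move=> f2 g2; rewrite -(@ler_pXn2r _ 2)// ?nnegrE ?mulr_ge0 ?l2norm_ge0//.
rewrite exprMn !sqr_l2norm real_normK ?num_real//.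
apply: discriminant_le => t.
have := inner_ge0 (t *: f + g); have tf := L2Z t f2.
rewrite innerDl ?innerDr ?innerZl ?innerZr//; last exact: L2D.
by rewrite [inner g f]innerC; lra.
Qed.

Lemma l2normZ a f : L2 f -> l2norm (a *: f) = `|a| * l2norm f.
Proof.
move=> f2; rewrite /Defs.l2norm innerZl ?innerZr//; last exact: L2Z.
by rewrite mulrA -expr2 sqrtrM ?sqr_ge0// sqrtr_sqr.
Qed.

Lemma l2normD f g : L2 f -> L2 g -> l2norm (f + g) <= l2norm f + l2norm g.
Proof.
move=> f2 g2; rewrite -(@ler_pXn2r _ 2)// ?nnegrE ?addr_ge0 ?l2norm_ge0//.
rewrite sqr_l2norm innerDl ?innerDr//; last exact: L2D.
have := le_trans (ler_norm _) (cauchy_schwarz f2 g2).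
by rewrite sqrrD !sqr_l2norm [inner g f]innerC; lra.
Qed.

Lemma l2norm_le f (B : R) : L2 f -> 0 <= B ->
  (forall v, L2 v -> `|inner f v| <= B * l2norm v) -> l2norm f <= B.
Proof.
move=> f2 B0 /(_ f f2) H; have := le_trans (ler_norm _) H.
rewrite -sqr_l2norm expr2; have := l2norm_ge0 f.
rewrite le_eqVlt => /orP[/eqP <-//|f0].
by rewrite ler_pM2r.
Qed.

Lemma dense_orthogonal_eq0 (D : set field) f : l2_dense vol D -> D `<=` L2 ->
  L2 f -> (forall w, D w -> inner f w = 0) -> f = 0 %[ae vol].
Proof.
move=> dD DL f2 fD; apply: l2norm_eq0 => //.
apply/eqP; rewrite eq_le l2norm_ge0 andbT; apply/ler_addgt0Pl => e e0.
rewrite addr0; have [g Dg fg] := dD f f2 e e0.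
have g2 := DL _ Dg; have [->|f0] := eqVneq (l2norm f) 0; first exact: ltW.
have {}f0 : 0 < l2norm f by rewrite lt_def f0 l2norm_ge0.
have := cauchy_schwarz f2 (L2B f2 g2).
rewrite innerBr// (fD g)// subr0 -sqr_l2norm ger0_norm ?sqr_ge0// expr2.
by rewrite ler_pM2l// => /le_trans; apply; exact: ltW.
Qed.

Section Symmetric_operator.
Variables (D : set field) (A : field -> field).
Hypothesis symA : symmetric_operator vol D A.

Lemma dom_L2 u : D u -> L2 u.
Proof. by have [[+ _ _] _ _ _ _] := symA; exact. Qed.

Lemma dom_lin a u v : D u -> D v -> D (a *: u + v).
Proof. by have [[_ _ +] _ _ _ _] := symA; apply. Qed.

Lemma dom0 : D 0.
Proof. by have [[_ + _] _ _ _ _] := symA. Qed.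

Lemma domZ a u : D u -> D (a *: u).
Proof. by move=> Du; rewrite -[_ *: _]addr0; apply: dom_lin => //; exact: dom0. Qed.

Lemma domD u v : D u -> D v -> D (u + v).
Proof. by move=> Du Dv; rewrite -[u]scale1r; exact: dom_lin. Qed.

Lemma domB u v : D u -> D v -> D (u - v).
Proof. by move=> Du Dv; apply: domD => //; rewrite -scaleN1r; exact: domZ. Qed.

Lemma op_L2 u : D u -> L2 (A u).
Proof. exact: symop_L2 symA _. Qed.

Lemma op_sym u v : D u -> D v -> inner (A u) v = inner u (A v).
Proof. exact: symop_sym symA _ _. Qed.

Lemma opD u v : D u -> D v -> A (u + v) = A u + A v.
Proof. by move=> Du Dv; rewrite -[u]scale1r (symop_linear symA)// !scale1r. Qed.

Lemma op0 : A 0 = 0.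
Proof.
have /eqP := opD dom0 dom0; rewrite addr0 => /eqP A0.
by apply: (addrI (A 0)); rewrite -A0 addr0.
Qed.

Lemma opZ a u : D u -> A (a *: u) = a *: A u.
Proof.
move=> Du; rewrite -[a *: u]addr0 (symop_linear symA)//; last exact: dom0.
by rewrite op0 addr0.
Qed.

Lemma opB u v : D u -> D v -> A (u - v) = A u - A v.
Proof.
move=> Du Dv; have DNv := domZ (-1) Dv.
by rewrite -(scaleN1r v) opD// opZ// scaleN1r.
Qed.

Lemma op_ae0 u : D u -> u = 0 %[ae vol] -> A u = 0 %[ae vol].
Proof.
move=> Du u0; apply: (dense_orthogonal_eq0 (symop_dense symA)).
- exact: dom_L2.
- exact: op_L2.
move=> w Dw; rewrite op_sym// -(inner0l (A w)).
by apply: inner_ae => //; [exact: dom_L2|exact: L2_0|exact: op_L2..|exact: ae_eq_refl].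
Qed.

(* Cauchy-Schwarz for the semi-definite form (-A u, w). *)
Lemma nonpositive_op_eq0 u : nonpositive_on vol D A -> D u ->
  inner u (A u) = 0 -> A u = 0 %[ae vol].
Proof.
move=> negA Du uAu; apply: (dense_orthogonal_eq0 (symop_dense symA)).
- exact: dom_L2.
- exact: op_L2.
move=> w Dw; apply/eqP; rewrite -sqrf_eq0 eq_le sqr_ge0 andbT.
rewrite -(mul0r (- inner w (A w))).
apply: discriminant_le => t.
have Dtu := domZ (- t) Du.
have := negA _ (domD Dtu Dw).
rewrite opD// opZ//.
have [u2 w2] := (dom_L2 Du, dom_L2 Dw).
have [Au2 Aw2] := (op_L2 Du, op_L2 Dw).
have [tu2 tAu2] := (L2Z (- t) u2, L2Z (- t) Au2).
rewrite innerDl//; last exact: L2D.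
rewrite !innerDr// !innerZl// !innerZr// uAu -op_sym// [inner w _]innerC.
by lra.
Qed.

End Symmetric_operator.
End L2_space.

Section Mean_value.
Context {R : realType}.
Implicit Types (f g : R -> R) (a b e t x : R).

Lemma time_derivative_diff_bound (T : R) f f' t e :
  @time_derivative R R^o Num.norm T f f' -> 0 <= t <= T -> 0 < e ->
  exists2 delta, 0 < delta & forall s, `|s - t| < delta -> 0 <= s <= T ->
    `|f s - f t - f' t * (s - t)| <= e * `|s - t|.
Proof.
move=> df tT e0; have /cvgrPdist_le/(_ e e0) := df t tT.
rewrite near_withinE => /nbhs_ballP[delta /= delta0 H].
exists delta => // s st sT; have [->|sNt] := eqVneq s t.
  by rewrite !subrr mulr0 subr0 normr0 mulr0.
have /= := H s; rewrite -ball_normE /= distrC => /(_ st sNt).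
rewrite in_itv/= => /(_ sT); rewrite sub0r normrN normr_id => H'.
have st0 : s - t != 0 by rewrite subr_eq0.
have -> : f s - f t - f' t * (s - t) = ((s - t)^-1 * (f s - f t) - f' t) * (s - t).
  by field.
by rewrite normrM ler_pM2r ?normr_gt0.
Qed.

Lemma is_derive_diff_bound f x l :
  (forall e, 0 < e -> exists2 delta, 0 < delta & forall s, `|s - x| < delta ->
    `|f s - f x - l * (s - x)| <= e * `|s - x|) ->
  is_derive x (1 : R) f l.
Proof.
move=> H.
suff C : h^-1 *: ((f \o shift x) (h *: (1 : R)) - f x) @[h --> (0 : R)^'] --> l.
  by apply: DeriveDef; [apply: cvgP C|apply: (cvg_lim _ C)].
apply/cvgrPdist_le => e e0; have [delta delta0 {}H] := H e e0.
near=> h.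
have h0 : h != 0 by near: h; exact: nbhs_dnbhs_neq.
have hd : `|h| < delta by near: h; exact: dnbhs0_lt.
have := H (h *: (1 : R) + x); rewrite addrK /= /GRing.scale/= mulr1 => /(_ hd).
rewrite distrC => H'.
rewrite -(ler_pM2r (_ : 0 < `|h|)) ?normr_gt0// -normrM.
apply: le_trans H'; rewrite le_eqVlt; apply/orP; left; apply/eqP.
by congr (`|_|); field.
Unshelve. all: by end_near. Qed.

Lemma time_derivative_is_derive (T : R) f f' x :
  @time_derivative R R^o Num.norm T f f' -> 0 < x < T -> is_derive x (1 : R) f (f' x).
Proof.
move=> df /andP[x0 xT]; apply: is_derive_diff_bound => e e0.
have xT' : 0 <= x <= T by rewrite !ltW.
have [delta delta0 H] := time_derivative_diff_bound df xT' e0.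
exists (Num.min delta (Num.min x (T - x))).
  by rewrite !lt_min delta0 x0 subr_gt0.
move=> s; rewrite !lt_min => /and3P[sd]; rewrite !ltr_norml => sx sT.
by apply: H => //; lra.
Qed.

Lemma time_derivative_continuous (T : R) f f' a b :
  @time_derivative R R^o Num.norm T f f' -> 0 <= a -> b <= T ->
  {within `[a, b], continuous f}.
Proof.
move=> df a0 bT; apply/subspace_continuousP => x /=; rewrite in_itv/= => xab.
have xT : 0 <= x <= T by lra.
have [delta delta0 H] := time_derivative_diff_bound df xT (@ltr01 R).
apply/cvgrPdist_le => e e0; rewrite near_withinE; apply/nbhs_ballP.
have C0 : 0 < 1 + `|f' x| by rewrite ltr_pwDl.
exists (Num.min delta (e / (1 + `|f' x|))) => /=.
  by rewrite lt_min delta0 divr_gt0.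
move=> s; rewrite -ball_normE /= distrC lt_min ltr_pdivlMr// => /andP[sd se].
rewrite in_itv/= => sab; have {}H := H s sd ltac:(lra).
rewrite distrC.
have -> : f s - f x = (f s - f x - f' x * (s - x)) + f' x * (s - x) by ring.
rewrite (le_trans (ler_normD _ _))// normrM.
by move: H se; rewrite mul1r; lra.
Qed.

Lemma mean_value_affine (T : R) f f' a b (p q B : R) :
  @time_derivative R R^o Num.norm T f f' -> 0 <= a -> a <= b -> b <= T ->
  (forall s, a <= s <= b -> `|f' s - (p + q * s)| <= B) ->
  `|f b - f a - (p * (b - a) + q / 2 * (b ^+ 2 - a ^+ 2))| <= B * (b - a).
Proof.
move=> df a0 ab bT HB.
pose P := p \*: (@id R) + (q / 2) \*: (fun x : R => x ^+ 2).
have dP (x : R) : is_derive x (1 : R) P (p + q * x).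
  apply: is_derive_eq; by rewrite /GRing.scale/=; field.
have dF x : x \in `]a, b[%R -> is_derive x (1 : R) (f - P) (f' x - (p + q * x)).
  rewrite in_itv/= => /andP[ax xb]; apply: is_deriveB.
  by apply: (time_derivative_is_derive df); lra.
have cF : {within `[a, b], continuous (f - P)}.
  apply: within_continuousB; first exact: time_derivative_continuous df a0 bT.
  apply: continuous_subspaceT => x; apply: differentiable_continuous.
  exact/derivable1_diffP/ex_derive.
have [c] := MVT_segment ab dF cF; rewrite in_itv/= => cab.
rewrite -[X in X - _]/(f b - (p * b + q / 2 * b ^+ 2)).
rewrite -[X in _ - X]/(f a - (p * a + q / 2 * a ^+ 2)) => E.
have -> : f b - f a - (p * (b - a) + q / 2 * (b ^+ 2 - a ^+ 2)) =
    (f' c - (p + q * c)) * (b - a) by rewrite -E; field.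
rewrite normrM (ger0_norm (_ : 0 <= b - a)) ?subr_ge0//.
by rewrite ler_wpM2r ?subr_ge0// HB.
Qed.

Lemma mean_value_bound (T : R) f f' (B : R) :
  @time_derivative R R^o Num.norm T f f' ->
  (forall s, 0 <= s <= T -> `|f' s| <= B) ->
  forall a b, 0 <= a -> a <= b -> b <= T -> `|f b - f a| <= B * (b - a).
Proof.
move=> df HB a b a0 ab bT.
have /= := @mean_value_affine T f f' a b 0 0 B df a0 ab bT.
rewrite !mul0r !addr0 subr0; apply => s sab.
by rewrite mul0r addr0 subr0; apply: HB; lra.
Qed.

(* With H s = g s - g t - (s - t) g1 t - (s - t) ^ 2 / 2 g2 t, the left-hand
   side is H (t - 2 h) - 4 H (t - h). *)
Lemma bdf2_taylor (T : R) g g1 g2 g3 (K t h : R) :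
  @time_derivative R R^o Num.norm T g g1 -> @time_derivative R R^o Num.norm T g1 g2 ->
  @time_derivative R R^o Num.norm T g2 g3 ->
  (forall s, 0 <= s <= T -> `|g3 s| <= K) ->
  0 <= h -> 0 <= t - 2 * h -> t <= T ->
  `|3 * g t - 4 * g (t - h) + g (t - 2 * h) - 2 * h * g1 t| <= 40 * K * h ^+ 3.
Proof.
move=> d1 d2 d3 HK h0 t0 tT.
have K0 : 0 <= K by apply: le_trans (HK t ltac:(lra)).
have B2 s : t - 2 * h <= s <= t -> `|g2 s - g2 t| <= 2 * h * K.
  move=> /andP[s1 s2]; rewrite distrC; have s0 := le_trans t0 s1.
  apply: le_trans (mean_value_bound d3 HK s0 s2 tT) _.
  by rewrite mulrC ler_wpM2r//; lra.
have B1 s : t - 2 * h <= s <= t ->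
    `|g1 s - (g1 t - g2 t * t + g2 t * s)| <= 4 * h ^+ 2 * K.
  move=> /andP[s1 s2]; have s0 := le_trans t0 s1.
  have /= := @mean_value_affine T g1 g2 s t (g2 t) 0 (2 * h * K) d2.
  move=> /(_ s0 s2 tT).
  have -> : g1 t - g1 s - (g2 t * (t - s) + 0 / 2 * (t ^+ 2 - s ^+ 2)) =
    - (g1 s - (g1 t - g2 t * t + g2 t * s)) by field.
  rewrite normrN => H; apply: le_trans (H _) _.
    by move=> u us; rewrite mul0r addr0; apply: B2; lra.
  rewrite (_ : 4 * _ * K = 2 * h * K * (2 * h)); last ring.
  by apply: ler_wpM2l; [rewrite !mulr_ge0|lra].
have B0 s : t - 2 * h <= s <= t ->
    `|g t - g s - ((g1 t - g2 t * t) * (t - s) + g2 t / 2 * (t ^+ 2 - s ^+ 2))|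
    <= 8 * K * h ^+ 3.
  move=> /andP[s1 s2]; have s0 := le_trans t0 s1.
  apply: le_trans (@mean_value_affine T g g1 s t _ _ (4 * h ^+ 2 * K) d1 s0 s2 tT _) _.
  - by move=> u us; apply: B1; lra.
  rewrite (_ : 8 * K * _ = 4 * h ^+ 2 * K * (2 * h)); last ring.
  by apply: ler_wpM2l; [rewrite !mulr_ge0 ?sqr_ge0|lra].
have := B0 (t - h) ltac:(lra); have := B0 (t - 2 * h) ltac:(lra).
set H2 := (X in `|X| <= _); set H1 := (X in _ -> `|X| <= _ -> _) => b2 b1.
have -> : 3 * g t - 4 * g (t - h) + g (t - 2 * h) - 2 * h * g1 t = 4 * H1 - H2.
  by rewrite /H1 /H2; field.
rewrite (le_trans (ler_normB _ _))// normrM ger0_norm//.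
by move: b1 b2; lra.
Qed.

End Mean_value.

Ltac l2_closed := repeat first
  [ assumption | apply: L2D | apply: L2B | apply: L2Z | apply: L2N ].

Ltac inner_expand :=
  repeat first [ rewrite innerBr; [|solve [l2_closed]..]
               | rewrite innerDr; [|solve [l2_closed]..]
               | rewrite innerZr; [|solve [l2_closed]..]
               | rewrite innerBl; [|solve [l2_closed]..]
               | rewrite innerDl; [|solve [l2_closed]..]
               | rewrite innerZl; [|solve [l2_closed]..] ].

Section L2_time.
Context {R : realType} {d : measure_display} {Omega : measurableType d}.
Variable vol : {measure set Omega -> \bar R}.
Local Notation field := (Omega -> R).
Local Notation L2 := (L2 vol).
Local Notation inner := (inner vol).
Local Notation l2norm := (l2norm vol).
Variable T : R.
Implicit Types (f g : R -> field) (v : field).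
Local Notation L2_on f := (forall t : R, 0 <= t <= T -> L2 (f t)).

Lemma time_derivative_inner f f' v :
  time_derivative l2norm T f f' -> L2_on f -> L2_on f' -> L2 v ->
  @time_derivative R R^o Num.norm T (fun t => inner (f t) v)
    (fun t => inner (f' t) v).
Proof.
move=> df fL f'L vL t tT.
apply: (@squeeze_cvgr _ _ _ _ (fun=> 0)
  (fun s => l2norm ((s - t)^-1 *: (f s - f t) - f' t) * l2norm v)); last 2 first.
- exact: cvg_cst.
- rewrite -[X in _ --> X](mul0r (l2norm v)); apply: cvgM (cvg_cst _).
  exact: df.
rewrite near_withinE; near=> s; rewrite /= in_itv/= => sT.
have [fsL ftL f'tL] := And3 (fL s sT) (fL t tT) (f'L t tT).
rewrite normr_ge0 /=.
rewrite -[X in `|X|]/((s - t)^-1 * (inner (f s) v - inner (f t) v) - inner (f' t) v).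
rewrite -innerBl// -innerZl//; last exact: L2B.
rewrite -innerBl//; last exact/L2Z/L2B.
by apply: cauchy_schwarz => //; exact/L2B/f'tL/L2Z/L2B.
Unshelve. all: by end_near. Qed.

Lemma l2_mean_value_bound f f' (B : R) :
  time_derivative l2norm T f f' -> L2_on f -> L2_on f' ->
  (forall t, 0 <= t <= T -> l2norm (f' t) <= B) ->
  forall a b, 0 <= a -> a <= b -> b <= T -> l2norm (f b - f a) <= B * (b - a).
Proof.
move=> df fL f'L HB a b a0 ab bT.
have aT : 0 <= a <= T by rewrite a0 (le_trans ab).
have bT' : 0 <= b <= T by rewrite (le_trans a0).
have B0 : 0 <= B := le_trans (l2norm_ge0 _ _) (HB a aT).
apply: l2norm_le => [||v vL].
- by apply: L2B; exact: fL.
- by rewrite mulr_ge0// subr_ge0.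
rewrite (innerBl (fL b bT') (fL a aT) vL) mulrAC.
apply: (mean_value_bound (time_derivative_inner df fL f'L vL)) => // s sT.
apply: le_trans (cauchy_schwarz _ _) _ => //; first exact: f'L.
by rewrite ler_wpM2r ?l2norm_ge0// HB.
Qed.

Lemma l2_bounded_of_derivative f f' (B : R) : 0 <= T ->
  time_derivative l2norm T f f' -> L2_on f -> L2_on f' ->
  (forall t, 0 <= t <= T -> l2norm (f' t) <= B) ->
  exists C, forall t, 0 <= t <= T -> l2norm (f t) <= C.
Proof.
move=> T0 df fL f'L HB; exists (l2norm (f 0) + B * T) => t /andP[t0 tT].
have Z : 0 <= (0 : R) <= T by rewrite lexx.
have B0 : 0 <= B := le_trans (l2norm_ge0 _ _) (HB 0 Z).
have [f0L ftL] : L2 (f 0) /\ L2 (f t) by split; apply: fL; rewrite ?t0.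
rewrite -[f t](subrKC (f 0)) (le_trans (l2normD _ _))//; first exact: L2B.
rewrite lerD2l (le_trans (l2_mean_value_bound df fL f'L HB (lexx 0) t0 tT))//.
by rewrite subr0 ler_wpM2l.
Qed.

Lemma l2_bdf2_taylor g g1 g2 g3 (K t h : R) :
  time_derivative l2norm T g g1 -> time_derivative l2norm T g1 g2 ->
  time_derivative l2norm T g2 g3 ->
  L2_on g -> L2_on g1 -> L2_on g2 -> L2_on g3 ->
  (forall s, 0 <= s <= T -> l2norm (g3 s) <= K) ->
  0 <= h -> 0 <= t - 2 * h -> t <= T ->
  l2norm (bdf2 (g (t - 2 * h)) (g (t - h)) (g t) - (2 * h) *: g1 t)
    <= 40 * K * h ^+ 3.
Proof.
move=> d1 d2 d3 L0 L1 L2' L3 HK h0 t0 tT.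
have [tT0 tT1 tT2] : [/\ 0 <= t <= T, 0 <= t - h <= T & 0 <= t - 2 * h <= T].
  by split; lra.
have [G0 G1 G2 G3] := And4 (L0 _ tT0) (L0 _ tT1) (L0 _ tT2) (L1 _ tT0).
have K0 : 0 <= K := le_trans (l2norm_ge0 _ _) (HK t tT0).
apply: l2norm_le => [||v vL].
- by rewrite /bdf2; l2_closed.
- by rewrite !mulr_ge0 ?exprn_ge0.
have -> : inner (bdf2 (g (t - 2 * h)) (g (t - h)) (g t) - (2 * h) *: g1 t) v =
    3 * inner (g t) v - 4 * inner (g (t - h)) v + inner (g (t - 2 * h)) v -
    2 * h * inner (g1 t) v.
  by rewrite /bdf2; inner_expand.
rewrite (_ : _ * l2norm v = 40 * (K * l2norm v) * h ^+ 3); last by ring.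
apply: (bdf2_taylor (time_derivative_inner d1 L0 L1 vL)
  (time_derivative_inner d2 L1 L2' vL) (time_derivative_inner d3 L2' L3 vL)) => //.
move=> s sT; apply: le_trans (cauchy_schwarz (L3 s sT) vL) _.
by rewrite ler_wpM2r ?l2norm_ge0// HK.
Qed.

End L2_time.

Lemma inv_sqrt_lipschitz (R : realType) (c a b : R) : 0 < c -> c <= a -> c <= b ->
  `|(Num.sqrt a)^-1 - (Num.sqrt b)^-1| <= `|a - b| / Num.sqrt c ^+ 3.
Proof.
move=> c0 ca cb.
have [a0 b0] := (lt_le_trans c0 ca, lt_le_trans c0 cb).
have [sa sb sc] : [/\ 0 < Num.sqrt a, 0 < Num.sqrt b & 0 < Num.sqrt c].
  by rewrite !sqrtr_gt0.
have [ac bc] : Num.sqrt c <= Num.sqrt a /\ Num.sqrt c <= Num.sqrt b.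
  by split; exact: ler_wsqrtr.
have Ea := sqr_sqrtr (ltW a0); have Eb := sqr_sqrtr (ltW b0).
move: (Num.sqrt a) (Num.sqrt b) (Num.sqrt c) sa sb sc ac bc Ea Eb.
move=> x y z x0 y0 z0 zx zy <- <-.
have -> : x^-1 - y^-1 = (y ^+ 2 - x ^+ 2) / (x * y * (x + y)).
  by field; rewrite !gt_eqF// addr_gt0.
have xy0 : 0 < x * y * (x + y) by rewrite !mulr_gt0// addr_gt0.
rewrite normrM distrC ler_wpM2l// gtr0_norm ?invr_gt0// lef_pV2 ?posrE ?exprn_gt0//.
have -> : z ^+ 3 = z * z * z by ring.
have zz : z * z <= x * y by apply: ler_pM => //; exact: ltW.
by apply: ler_pM => //; [rewrite mulr_ge0// ltW|exact: ltW|lra].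
Qed.

Section Scheme.
Context {R : realType} {d : measure_display} {Omega : measurableType d}.
Variable vol : {measure set Omega -> \bar R}.
Local Notation field := (Omega -> R).
Local Notation L2 := (L2 vol).
Local Notation inner := (inner vol).
Local Notation l2norm := (l2norm vol).
Variables (domG domL : set field) (G L : field -> field).
Variables (E1 : field -> R) (U : field -> field) (C0 : R).
Hypothesis symG : symmetric_operator vol domG G.
Hypothesis negG : nonpositive_on vol domG G.
Hypothesis symL : symmetric_operator vol domL L.
Hypothesis posL : nonnegative_on vol domL L.
Hypothesis C0_gt0 : 0 < C0.
Hypothesis E1_ge : forall v : field, domL v -> C0 <= E1 v.
Hypothesis dE1 : variational_derivative vol domL E1 U.

Lemma pointwiseE :
  (forall (f g : field) x, (f + g) x = f x + g x) *
  (forall (f : field) x, (- f) x = - f x) *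
  (forall (a : R) (f : field) x, (a *: f) x = a * f x) *
  (forall x : Omega, (0 : field) x = 0).
Proof. by []. Qed.

Lemma L2_bdf2 (u0 u1 u2 : field) : L2 u0 -> L2 u1 -> L2 u2 -> L2 (bdf2 u0 u1 u2).
Proof. by move=> *; rewrite /bdf2; l2_closed. Qed.

Lemma U_L2 (v : field) : domL v -> L2 (U v).
Proof. by have [+ _] := dE1; apply. Qed.

Lemma bdf2_energy_identity (u0 u1 u2 : field) :
  domL u0 -> domL u1 -> domL u2 ->
  inner u2 (L u2) + inner (2%:R *: u2 - u1) (L (2%:R *: u2 - u1)) -
  (inner u1 (L u1) + inner (2%:R *: u1 - u0) (L (2%:R *: u1 - u0))) +
  inner (u2 - 2%:R *: u1 + u0) (L (u2 - 2%:R *: u1 + u0)) =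
  2 * inner (L u2) (bdf2 u0 u1 u2).
Proof.
move=> D0 D1 D2.
have [[L0 L1] L2'] := ((dom_L2 symL D0, dom_L2 symL D1), dom_L2 symL D2).
have [[A0 A1] A2] := ((op_L2 symL D0, op_L2 symL D1), op_L2 symL D2).
have [Z2 Z1] := (domZ symL 2%:R D2, domZ symL 2%:R D1).
have B1 := domB symL D2 Z1.
rewrite (opB symL Z2 D1) (opB symL Z1 D0) (opD symL B1 D0) (opB symL D2 Z1).
rewrite !(opZ symL)// /bdf2.
inner_expand.
rewrite !(op_sym symL)//.
have -> : inner u1 (L u2) = inner u2 (L u1) by rewrite -(op_sym symL)// innerC.
have -> : inner u0 (L u2) = inner u2 (L u0) by rewrite -(op_sym symL)// innerC.
have -> : inner u0 (L u1) = inner u1 (L u0) by rewrite -(op_sym symL)// innerC.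
ring.
Qed.

Lemma energy_law (dt : R) (phibar phi0 phi1 : field) (r0 r1 : R)
    (phi2 mu2 : field) (r2 : R) :
  0 < dt -> domL phibar -> domL phi0 -> domL phi1 ->
  sav_bdf_step vol domG domL G L E1 U dt phibar phi0 phi1 r0 r1 phi2 mu2 r2 ->
  dt^-1 * (modified_energy vol L phi2 r2 phi1 r1 -
           modified_energy vol L phi1 r1 phi0 r0) +
  dt^-1 * (4%:R^-1 * inner (phi2 - 2%:R *: phi1 + phi0)
                           (L (phi2 - 2%:R *: phi1 + phi0)) +
           2%:R^-1 * (r2 - 2%:R * r1 + r0) ^+ 2) =
  inner mu2 (G mu2).
Proof.
move=> dt0 Db D0 D1 [D2 Dmu ephi emu er].
have UL := U_L2 Db.
have VL : L2 (bdf2 phi0 phi1 phi2).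
  by apply: L2_bdf2; apply: (dom_L2 symL).
have A2 := op_L2 symL D2.
have := bdf2_energy_identity D0 D1 D2.
move: (bdf2 _ _ _) ephi er VL => V ephi er VL.
have -> : inner mu2 (G mu2) = (2%:R * dt)^-1 *
    (inner (L phi2) V + r2 / Num.sqrt (E1 phibar) * inner (U phibar) V).
  rewrite -(innerZl (r2 / _))// -innerDl -?innerZr; try by l2_closed.
  apply: inner_ae => //; try by l2_closed.
  - exact: (dom_L2 symG).
  - exact: (op_L2 symG).
  - exact: ae_eq_sym.
move: er; rewrite innerZl// /modified_energy invfM.
move: (inner (L phi2) V) (inner (U phibar) V) (Num.sqrt _)^-1 => a b s er H.
have -> : r2 * s * b = 2 * r2 * (3%:R * r2 - 4%:R * r1 + r0).
  by rewrite er; field.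
move: H; move: (inner (phi2 - _ + _) _) (inner phi2 _) (inner phi1 _).
move: (inner (_ *: phi2 - _) _) (inner (_ *: phi1 - _) _) => p q w x y H.
have -> : a = (x + p - (y + q) + w) / 2 by rewrite H; field.
by field; rewrite gt_eqF.
Qed.

Lemma sav_bdf_stepE (dt : R) (phibar phi0 phi1 : field) (r0 r1 : R)
    (phi2 mu2 : field) (r2 : R) :
  0 < dt -> domL phibar -> domL phi0 -> domL phi1 ->
  let beta := sav_beta E1 U phibar in
  let phistar := sav_phistar phi0 phi1 in
  sav_bdf_step vol domG domL G L E1 U dt phibar phi0 phi1 r0 r1 phi2 mu2 r2 <->
  [/\ domL phi2, domG mu2,
      phi2 - phistar = sav_lambda dt *: G mu2 %[ae vol],
      mu2 = L phi2 + r2 *: beta %[ae vol] &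
      r2 = sav_rstar r0 r1 + (inner beta phi2 - inner beta phistar) / 2].
Proof.
move=> dt0 Db D0 D1 beta phistar.
have UL := U_L2 Db.
have [L0 L1] := (dom_L2 symL D0, dom_L2 symL D1).
have eqphi (x y z g : R) : (2%:R * dt)^-1 * (3%:R * z - 4%:R * y + x) = g <->
    z - 3%:R^-1 * (4%:R * y - x) = sav_lambda dt * g.
  rewrite /sav_lambda; split=> [<-|H]; first by field; rewrite gt_eqF.
  have -> : g = (z - 3%:R^-1 * (4%:R * y - x)) / (2%:R / 3%:R * dt).
    by rewrite H; field; rewrite gt_eqF.
  by field; rewrite gt_eqF.
have Ebeta : (r2 / Num.sqrt (E1 phibar)) *: U phibar = r2 *: beta.
  by rewrite /beta /sav_beta scalerA.
have bL : L2 beta by apply: L2Z.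
split=> -[D2 Dmu ephi emu er]; have L2' := dom_L2 symL D2; split => //.
- by apply: filterS ephi => x /(_ I) + _; rewrite /bdf2 => /eqphi.
- by rewrite -Ebeta.
- move: er; rewrite invfM -scalerA -/beta /phistar /sav_phistar /sav_rstar /bdf2.
  inner_expand.
  by move=> er; lra.
- by apply: filterS ephi => x /(_ I) /eqphi + _.
- by rewrite Ebeta.
rewrite invfM -scalerA -/beta.
move: er; rewrite /phistar /sav_phistar /sav_rstar /bdf2.
inner_expand.
by move=> er; lra.
Qed.

Lemma coupled_eq0 (lambda : R) (beta p m : field) (r : R) :
  0 < lambda -> L2 beta -> domL p -> domG m ->
  p = lambda *: G m %[ae vol] -> m = L p + r *: beta %[ae vol] ->
  r = inner beta p / 2 ->
  [/\ p = 0 %[ae vol], m = 0 %[ae vol] & r = 0].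
Proof.
move=> lam0 bL Dp Dm ep em er.
have [pL mL] := (dom_L2 symL Dp, dom_L2 symG Dm).
have [LpL GmL] := (op_L2 symL Dp, op_L2 symG Dm).
have Hp : inner m p = lambda * inner m (G m).
  rewrite -innerZr//; apply: inner_ae => //; by [exact: L2Z|exact: ae_eq_refl].
have Hm : inner m p = inner p (L p) + 2 * r ^+ 2.
  have -> : inner m p = inner (L p + r *: beta) p.
    by apply: inner_ae => //; [l2_closed|exact: ae_eq_refl].
  by inner_expand; rewrite innerC expr2 {3}er; field.
have [pLp mGm] := (posL Dp, negG Dm).
have r2 := sqr_ge0 r.
have lmGm : lambda * inner m (G m) <= 0 by rewrite pmulr_rle0.
have r0 : r = 0 by apply/eqP; rewrite -sqrf_eq0 eq_le r2 andbT; lra.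
have mGm0 : inner m (G m) = 0.
  apply/eqP; have : lambda * inner m (G m) == 0 by rewrite eq_le lmGm; lra.
  by rewrite mulf_eq0 gt_eqF.
have Gm0 := nonpositive_op_eq0 symG negG Dm mGm0.
have p0 : p = 0 %[ae vol].
  apply: filterS2 ep Gm0 => x /(_ I) -> /(_ I) Gx _.
  by rewrite !pointwiseE Gx mulr0.
have Lp0 := op_ae0 symL Dp p0.
split=> //; apply: filterS2 em Lp0 => x /(_ I) -> /(_ I) Lx _.
by rewrite r0 scale0r addr0.
Qed.

Lemma sav_pairing_le0 (lambda : R) (beta xi : field) :
  0 < lambda -> domG beta ->
  solves_linear vol domG domL G L lambda (G beta) xi -> inner beta xi <= 0.
Proof.
move=> lam0 Db [Dx DLx ex].
pose w := lambda *: L xi + beta.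
have Dw : domG w by apply: (dom_lin symG).
have Gw : G w = lambda *: G (L xi) + G beta by apply: (symop_linear symG).
have [xL bL wL] := And3 (dom_L2 symL Dx) (dom_L2 symG Db) (dom_L2 symG Dw).
have LxL := op_L2 symL Dx.
have -> : inner beta xi = inner w xi - lambda * inner xi (L xi).
  by rewrite /w; inner_expand; rewrite [inner xi _]innerC; ring.
have -> : inner w xi = inner w (G w).
  apply: inner_ae => //; [exact: (op_L2 symG)|exact: ae_eq_refl|].
  apply: filterS ex => x /(_ I) + _; rewrite Gw.
  rewrite !pointwiseE.
  by move=> <-; rewrite addrC subrK.
by rewrite subr_le0 (le_trans (negG Dw))// mulr_ge0 ?posL// ltW.
Qed.

Lemma sav_step_solution (dt : R) (phibar phi0 phi1 : field) (r0 r1 : R)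
    (xi1 xi2 : field) :
  0 < dt -> domL phibar -> domG (U phibar) -> domL phi0 -> domL phi1 ->
  solves_linear vol domG domL G L (sav_lambda dt)
    (sav_rhs vol G E1 U dt phibar phi0 phi1 r0 r1) xi1 ->
  solves_linear vol domG domL G L (sav_lambda dt)
    (G (sav_beta E1 U phibar)) xi2 ->
  let phi2 := sav_phi vol E1 U dt phibar xi1 xi2 in
  let mu2 := sav_mu vol L E1 U dt phibar phi0 phi1 r0 r1 xi1 xi2 in
  let r2 := sav_r vol E1 U dt phibar phi0 phi1 r0 r1 xi1 xi2 in
  [/\ 1 - sav_lambda dt / 2%:R * inner (sav_beta E1 U phibar) xi2 != 0,
      sav_bdf_step vol domG domL G L E1 U dt phibar phi0 phi1 r0 r1 phi2 mu2 r2 &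
      forall (phi mu : field) (r : R),
        sav_bdf_step vol domG domL G L E1 U dt phibar phi0 phi1 r0 r1 phi mu r ->
        [/\ phi = phi2 %[ae vol], mu = mu2 %[ae vol] & r = r2]].
Proof.
move=> dt0 Db DUb D0 D1 s1 s2 phi2 mu2 r2.
have lam0 : 0 < sav_lambda dt by rewrite /sav_lambda mulr_gt0// divr_gt0 ?ltr0n.
have Dbeta : domG (sav_beta E1 U phibar) by apply: (domZ symG).
have bL := dom_L2 symG Dbeta.
have bxi2 := sav_pairing_le0 lam0 Dbeta s2.
have nz : 1 - sav_lambda dt / 2%:R * inner (sav_beta E1 U phibar) xi2 != 0.
  rewrite gt_eqF// subr_gt0 (@le_lt_trans _ _ 0)//.
  by rewrite mulr_ge0_le0// ltW// divr_gt0 ?ltr0n.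
have [Dx1 DLx1 ex1] := s1.
have [Dx2 DLx2 ex2] := s2.
have [x1L x2L] := (dom_L2 symL Dx1, dom_L2 symL Dx2).
have step : sav_bdf_step vol domG domL G L E1 U dt phibar phi0 phi1 r0 r1
              phi2 mu2 r2.
  have Dcx := domZ symL
    (sav_lambda dt / 2%:R * sav_pairing vol E1 U dt phibar xi1 xi2) Dx2.
  have D2 : domL phi2 by apply: (domD symL).
  have DL2 : domG (L phi2).
    rewrite /phi2 /sav_phi (opD symL)// (opZ symL)//.
    by apply: (domD symG) => //; apply: (domZ symG).
  have Dmu : domG mu2 by apply: (domD symG) => //; apply: (domZ symG).
  apply/sav_bdf_stepE => //; split => //.
  - have -> : G mu2 = G (L xi1) +
        (sav_lambda dt / 2%:R * sav_pairing vol E1 U dt phibar xi1 xi2) *: G (L xi2) +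
        r2 *: G (sav_beta E1 U phibar).
      rewrite /mu2 /sav_mu -/phi2 -/r2.
      rewrite (opD symG) ?(opZ symG)//; last exact: (domZ symG).
      rewrite /phi2 /sav_phi (opD symL)// (opZ symL)// (opD symG) ?(opZ symG)//.
      exact: (domZ symG).
    apply: filterS2 ex1 ex2 => x /(_ I) + /(_ I) + _.
    rewrite /phi2 /r2 /sav_phi /sav_rhs /sav_r.
    move: (sav_phistar _ _) (sav_rstar _ _) (sav_pairing _ _ _ _ _ _ _).
    move=> phistar rstar p.
    rewrite !pointwiseE.
    move: (inner _ phistar) (xi1 x) (xi2 x) (G (L xi1) x) (G (L xi2) x).
    move: (G (sav_beta _ _ _) x) (phistar x) => gb ps q a b ga gb2 e1 e2.
    have -> : a = sav_lambda dt * ga + (ps + sav_lambda dt * (rstar - q / 2) * gb).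
      by rewrite -e1; ring.
    have -> : b = sav_lambda dt * gb2 + gb by rewrite -e2; ring.
    by field.
  - exact: ae_eq_refl.
  rewrite {1}/r2 /sav_r; congr (_ + (_ - _) / _).
  rewrite /phi2 /sav_phi; inner_expand.
  by rewrite /sav_pairing; field; apply: contra_neq nz => h; lra.
split => // phi mu r /sav_bdf_stepE -/(_ dt0 Db D0 D1) [Dphi Dmu ephi emu er].
have [D2 Dmu2 ephi2 emu2 er2] := (sav_bdf_stepE r0 r1 phi2 mu2 r2 dt0 Db D0 D1).1 step.
have [Dp Dm] := (domB symL Dphi D2, domB symG Dmu Dmu2).
have [] := @coupled_eq0 (sav_lambda dt) (sav_beta E1 U phibar) (phi - phi2)
  (mu - mu2) (r - r2) lam0 bL Dp Dm.
- rewrite (opB symG)//; apply: filterS2 ephi ephi2 => x /(_ I) + /(_ I) + _.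
  rewrite !pointwiseE => e1 e2.
  by rewrite mulrBr -e1 -e2; ring.
- rewrite (opB symL)//; apply: filterS2 emu emu2 => x /(_ I) + /(_ I) + _.
  rewrite !pointwiseE => -> ->.
  by ring.
- rewrite innerBr//; try by apply: (dom_L2 symL).
  by rewrite {1}er {1}er2; field.
move=> p0 m0 /eqP; rewrite subr_eq0 => /eqP rr; split; last exact: rr.
- apply: filterS p0 => x /(_ I) + _.
  by rewrite !pointwiseE => /eqP; rewrite subr_eq0 => /eqP.
- apply: filterS m0 => x /(_ I) + _.
  by rewrite !pointwiseE => /eqP; rewrite subr_eq0 => /eqP.
Qed.

Lemma is_derive_segment (v w : field) (e : R) : domL v -> domL w ->
  is_derive e (1 : R) (fun e : R => E1 (v + e *: w)) (inner (U (v + e *: w)) w).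
Proof.
move=> Dv Dw; have Dvw := domD symL Dv (domZ symL e Dw).
have [_ /(_ _ w Dvw Dw)] := dE1.
set F0 := fun h : R => _; set F := fun h : R => _ => -[].
have E : (fun h : R => h^-1 *: ((F0 \o shift 0) (h *: (1 : R)) - F0 0)) =
    (fun h : R => h^-1 *: ((F \o shift e) (h *: (1 : R)) - F e)).
  apply/funext => h; congr (_ *: (_ - _)); rewrite /F0 /F /=; congr E1.
  - by rewrite addr0 scalerDl [X in _ = v + X]addrC addrA.
  - by rewrite scale0r addr0.
by rewrite /derivable /derive E => D1 D2; apply: DeriveDef.
Qed.

Lemma energy_segment_bound (v w : field) (B : R) : domL v -> domL w ->
  (forall e : R, 0 <= e <= 1 -> l2norm (U (v + e *: w)) <= B) ->
  `|E1 (v + w) - E1 v| <= B * l2norm w.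
Proof.
move=> Dv Dw HB.
set F := fun e : R => E1 (v + e *: w).
have dF e : is_derive e (1 : R) F (inner (U (v + e *: w)) w).
  exact: is_derive_segment.
have cF : {within `[0, 1], continuous F}.
  apply: continuous_subspaceT => e; apply: differentiable_continuous.
  exact/derivable1_diffP/ex_derive.
have [c] := MVT_segment ler01 (fun e _ => dF e) cF.
rewrite /F in_itv/= scale1r scale0r addr0 subr0 mulr1 => c01 ->.
apply: le_trans (cauchy_schwarz _ _) _.
- by apply: U_L2; apply: (domD symL) => //; apply: (domZ symL).
- exact: (dom_L2 symL).
by rewrite ler_wpM2r ?l2norm_ge0// HB.
Qed.

Section Norm.
Variable N : field -> R.
Hypothesis normN : norm_over_l2 vol domL N.
Hypothesis lipU : lipschitz_on_bounded_sets vol domL U N.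

Lemma normN0 : N 0 = 0.
Proof.
have [NZ _ _] := normN.
by rewrite -(scale0r (0 : field)) NZ ?normr0 ?mul0r//; exact: (dom0 symL).
Qed.

Lemma normN_opp (v : field) : domL v -> N (- v) = N v.
Proof. by have [NZ _ _] := normN => Dv; rewrite -scaleN1r NZ// normrN1 mul1r. Qed.

Lemma normN_distC (u v : field) : domL u -> domL v -> N (u - v) = N (v - u).
Proof. by move=> Du Dv; rewrite -normN_opp ?opprB//; exact: (domB symL). Qed.

Lemma normN_ge0 (v : field) : domL v -> 0 <= N v.
Proof.
move=> Dv; have [_ ND _] := normN; have DNv := domZ symL (-1) Dv.
have := ND _ _ Dv DNv; rewrite scaleN1r subrr normN0 normN_opp//.
by lra.
Qed.

Lemma U_bounded (M : R) : exists2 B, 0 <= B &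
  forall u, domL u -> N u <= M -> l2norm (U u) <= B.
Proof.
have [K HK] := lipU `|M|; have D0 := dom0 symL; have U0 := U_L2 D0.
exists (l2norm (U 0) + `|K| * `|M|).
  by rewrite addr_ge0 ?l2norm_ge0// mulr_ge0.
move=> u Du uM; have UuL := U_L2 Du.
have {}uM : N u <= `|M| := le_trans uM (ler_norm M).
rewrite -[U u](subrKC (U 0)) (le_trans (l2normD _ _))//; first exact: L2B.
rewrite lerD2l; apply: le_trans (HK u 0 Du D0 uM _) _; first by rewrite normN0.
rewrite subr0; apply: le_trans (ler_wpM2r _ (ler_norm K)) _; first exact: normN_ge0.
by rewrite ler_wpM2l.
Qed.

Lemma E1_lipschitz (M : R) : exists2 B, 0 <= B &
  forall u v, domL u -> domL v -> N u <= M -> N v <= M ->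
    `|E1 u - E1 v| <= B * N (u - v).
Proof.
have [B B0 HB] := U_bounded M; have [NZ ND [c Hc]] := normN.
exists (B * `|c|); first by rewrite mulr_ge0.
move=> u v Du Dv uM vM; have Duv := domB symL Du Dv.
rewrite -[in E1 u](subrKC v u).
apply: le_trans (energy_segment_bound (B := B) Dv Duv _) _; last first.
  rewrite -mulrA ler_wpM2l// (le_trans (Hc _ Duv))//.
  by rewrite ler_wpM2r ?ler_norm ?normN_ge0.
move=> e /andP[e0 e1].
have -> : v + e *: (u - v) = (1 - e) *: v + e *: u.
  by rewrite scalerBr scalerBl scale1r addrCA addrC.
have [Da Db] := (domZ symL (1 - e) Dv, domZ symL e Du).
apply: HB; first exact: (domD symL).
rewrite (le_trans (ND _ _ Da Db))// !NZ// !ger0_norm ?subr_ge0//.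
have -> : M = (1 - e) * M + e * M by ring.
by apply: lerD; apply: ler_wpM2l; rewrite ?subr_ge0.
Qed.

Lemma E1_bounded (M : R) : exists B, forall u, domL u -> N u <= M -> E1 u <= B.
Proof.
have [B B0 HB] := E1_lipschitz `|M|; have D0 := dom0 symL.
exists (E1 0 + B * `|M|) => u Du uM.
have {}uM : N u <= `|M| := le_trans uM (ler_norm M).
rewrite -lerBlDl (le_trans (ler_norm _))// (le_trans (HB u 0 Du D0 uM _)) ?normN0//.
by rewrite subr0 ler_wpM2l.
Qed.

Lemma beta_bounded (M : R) : exists2 B, 0 <= B &
  forall u, domL u -> N u <= M -> l2norm (sav_beta E1 U u) <= B.
Proof.
have [B B0 HB] := U_bounded M.
exists ((Num.sqrt C0)^-1 * B); first by rewrite mulr_ge0 ?invr_ge0 ?sqrtr_ge0.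
move=> u Du uM; have E1u := E1_ge Du.
rewrite l2normZ; last exact: U_L2.
rewrite ger0_norm ?invr_ge0 ?sqrtr_ge0// ler_pM ?invr_ge0 ?sqrtr_ge0 ?l2norm_ge0 ?HB//.
by rewrite lef_pV2 ?posrE ?sqrtr_gt0 ?ler_wsqrtr// (lt_le_trans C0_gt0).
Qed.

Lemma beta_lipschitz (M : R) : exists2 B, 0 <= B &
  forall u v, domL u -> domL v -> N u <= M -> N v <= M ->
    l2norm (sav_beta E1 U u - sav_beta E1 U v) <= B * N (u - v).
Proof.
have [BU BU0 HU] := U_bounded M; have [BE BE0 HE] := E1_lipschitz M.
have [K HK] := lipU M; set s := Num.sqrt C0.
have s0 : 0 < s by rewrite sqrtr_gt0.
exists (s^-1 * `|K| + BE / s ^+ 3 * BU).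
  by rewrite addr_ge0 ?mulr_ge0 ?invr_ge0 ?exprn_ge0// ltW.
move=> u v Du Dv uM vM.
have [E1u E1v] := (E1_ge Du, E1_ge Dv).
have [Uu Uv] := (U_L2 Du, U_L2 Dv); have UB := L2B Uu Uv.
have Nuv := normN_ge0 (domB symL Du Dv).
have -> : sav_beta E1 U u - sav_beta E1 U v = (Num.sqrt (E1 u))^-1 *: (U u - U v) +
    ((Num.sqrt (E1 u))^-1 - (Num.sqrt (E1 v))^-1) *: U v.
  by rewrite /sav_beta scalerBr scalerBl addrA subrK.
rewrite (le_trans (l2normD _ _)) ?l2normZ//; try exact: L2Z.
rewrite mulrDl; apply: lerD.
  rewrite ger0_norm ?invr_ge0 ?sqrtr_ge0// -mulrA.
  apply: ler_pM; rewrite ?invr_ge0 ?sqrtr_ge0 ?l2norm_ge0//.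
    by rewrite lef_pV2 ?posrE ?sqrtr_gt0 ?ler_wsqrtr// (lt_le_trans C0_gt0).
  by rewrite (le_trans (HK _ _ Du Dv uM vM))// ler_wpM2r// ler_norm.
rewrite mulrAC; apply: ler_pM; rewrite ?normr_ge0 ?l2norm_ge0 ?HU//.
rewrite (le_trans (inv_sqrt_lipschitz C0_gt0 E1u E1v))//.
rewrite mulrAC ler_wpM2r ?HE// invr_ge0 exprn_ge0// ltW.
Qed.

End Norm.

Lemma scheme_consistent (T : R) (phi phit mu : R -> field) (r rt : R -> R)
    (N : field -> R) (phibar : R -> nat -> field) :
  0 < T ->
  sav_solution vol domG domL G L E1 U T phi phit mu r rt ->
  smooth_in_time vol T phit rt ->
  norm_over_l2 vol domL N ->
  lipschitz_on_bounded_sets vol domL U N ->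
  (exists M : R, forall t : R, 0 <= t <= T -> N (phi t) <= M) ->
  second_order_approximation domL N T phi phibar ->
  second_order_accurate vol G L E1 U T phi mu r phibar.
Proof.
move=> T0 [Dphi phitL Dmu dphi dr ephi emu er rE].
move=> [[f1 [f2 [fL df1 df2 [K HK]]]] [q1 [q2 [_ dq1 dq2 [Kr HKr]]]]].
move=> normN lipU [M HM] [C [delta [delta0 Hbar]]].
have T0' := ltW T0.
have Z : 0 <= (0 : R) <= T by rewrite lexx.
have [K0 Kr0] : 0 <= K /\ 0 <= Kr.
  by split; [exact: le_trans (l2norm_ge0 _ _) (HK 0 Z)|
             exact: le_trans (normr_ge0 _) (HKr 0 Z)].
have phiL t : 0 <= t <= T -> L2 (phi t) by move=> /Dphi; exact: (dom_L2 symL).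
have f1L t : 0 <= t <= T -> L2 (f1 t) by move=> /fL[].
have f2L t : 0 <= t <= T -> L2 (f2 t) by move=> /fL[].
have [B1 HB1] := l2_bounded_of_derivative T0' df2 f1L f2L HK.
have [P HP] := l2_bounded_of_derivative T0' df1 phitL f1L HB1.
have P0 : 0 <= P := le_trans (l2norm_ge0 _ _) (HP 0 Z).
have [Bl Bl0 HBl] := beta_lipschitz normN lipU (M + `|C|).
have [Bb Bb0 HBb] := beta_bounded normN lipU (M + `|C|).
have [BE HBE] := E1_bounded normN lipU (M + `|C|).
have BlC0 : 0 <= Bl * `|C| by rewrite mulr_ge0.
pose c1 := 20 * K; pose c2 := Num.sqrt BE * (Bl * `|C|).
pose c3 := 20 * Kr + Bl * `|C| * P + Bb * c1.
have c10 : 0 <= c1 by rewrite mulr_ge0.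
have c20 : 0 <= c2 by rewrite mulr_ge0// sqrtr_ge0.
have c30 : 0 <= c3 by rewrite !addr_ge0 ?mulr_ge0.
exists (c1 + c2 + c3), (Num.min delta 1); split; first by rewrite lt_min delta0 ltr01.
move=> dt n /andP[dt0]; rewrite lt_min => /andP[dtd dt1] n0 tT.
have [Dbar Nbar] := Hbar dt n ltac:(by rewrite dt0 dtd) n0 tT.
set t := n.+1%:R * dt in tT Nbar.
have tn : n%:R * dt = t - dt by rewrite /t -natr1; ring.
have tn1 : n.-1%:R * dt = t - 2 * dt.
  by rewrite /t -[in RHS](prednK n0) -!natr1; ring.
have h0 : 0 <= t - 2 * dt by rewrite -tn1 mulr_ge0// ltW.
have tI : 0 <= t <= T by lra.
have dt2 : 0 <= dt ^+ 2 by rewrite sqr_ge0.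
have [D0 D1 D2] : [/\ domL (phi (t - 2 * dt)), domL (phi (t - dt)) & domL (phi t)].
  by split; apply: Dphi; lra.
have [G0 G1 G2] := And3 (dom_L2 symL D0) (dom_L2 symL D1) (dom_L2 symL D2).
have F0 := phitL t tI.
have NphiM : N (phi t) <= M + `|C| by rewrite (le_trans (HM t tI))// lerDl.
have Ndist : N (phibar dt n - phi t) <= `|C| * dt ^+ 2.
  by rewrite (le_trans Nbar)// ler_wpM2r// ler_norm.
have NbarM : N (phibar dt n) <= M + `|C|.
  have [_ ND _] := normN; rewrite -[phibar dt n](subrKC (phi t)).
  rewrite (le_trans (ND _ _ D2 (domB symL Dbar D2)))// lerD ?HM//.
  rewrite (le_trans Ndist)// ler_piMr// expr_le1 ?ltW//.
have Ndist' : N (phi t - phibar dt n) <= `|C| * dt ^+ 2.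
  by rewrite (normN_distC normN).
set beta := sav_beta E1 U (phi t); set betab := sav_beta E1 U (phibar dt n).
have [Uphi Ubar] := (U_L2 D2, U_L2 Dbar).
have [bL bbL] : L2 beta /\ L2 betab by split; exact: L2Z.
have dbeta : l2norm (beta - betab) <= Bl * `|C| * dt ^+ 2.
  by rewrite (le_trans (HBl _ _ D2 Dbar NphiM NbarM))// -mulrA ler_wpM2l.
set V := bdf2 (phi (t - 2 * dt)) (phi (t - dt)) (phi t).
have VL : L2 V by apply: L2_bdf2.
have dt2_ge0 : 0 <= 2 * dt by rewrite mulr_ge0// ltW.
have dtN0 : 2 * dt != 0 by rewrite mulf_neq0 ?gt_eqF.
have quot (x : R) : 40 * x * dt ^+ 3 = 20 * x * dt ^+ 2 * (2 * dt) by ring.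
have VB : l2norm ((2 * dt)^-1 *: V - phit t) <= c1 * dt ^+ 2.
  have -> : (2 * dt)^-1 *: V - phit t = (2 * dt)^-1 *: (V - (2 * dt) *: phit t).
    by rewrite scalerBr scalerA mulVf// scale1r.
  rewrite l2normZ; last by l2_closed.
  rewrite ger0_norm ?invr_ge0// [leLHS]mulrC ler_pdivrMr ?mulr_gt0// -quot.
  by apply: (l2_bdf2_taylor dphi df1 df2) => //; exact: ltW.
have rB : `|(2 * dt)^-1 * (3 * r t - 4 * r (t - dt) + r (t - 2 * dt)) - rt t|
    <= 20 * Kr * dt ^+ 2.
  have -> : (2 * dt)^-1 * (3 * r t - 4 * r (t - dt) + r (t - 2 * dt)) - rt t =
      (3 * r t - 4 * r (t - dt) + r (t - 2 * dt) - 2 * dt * rt t) / (2 * dt).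
    by field; rewrite gt_eqF.
  rewrite normrM normfV (ger0_norm dt2_ge0).
  rewrite ler_pdivrMr ?mulr_gt0// -quot.
  by apply: (bdf2_taylor dr dq1 dq2) => //; exact: ltW.
have le_sum x c : 0 <= c -> c <= c1 + c2 + c3 -> x <= c * dt ^+ 2 ->
    x <= (c1 + c2 + c3) * dt ^+ 2.
  by move=> c0 cc /le_trans; apply; rewrite ler_wpM2r.
split.
- apply: (le_sum _ c1) => //; first lra.
  rewrite (l2norm_ae (f' := (2 * dt)^-1 *: V - phit t))//.
  + rewrite /truncation_phi tn tn1 -/t; apply: L2B; first exact: L2Z.
    by apply: (op_L2 symG); exact: Dmu.
  + by l2_closed.
  apply: filterS (ephi t tI) => x /(_ I) + _.
  by rewrite /truncation_phi tn tn1 -/t !pointwiseE => ->.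
- apply: (le_sum _ c2) => //; first lra.
  rewrite (l2norm_ae (f' := r t *: (beta - betab)))//.
  + rewrite l2normZ; last by l2_closed.
    have rt_le : `|r t| <= Num.sqrt BE.
      by rewrite rE// ger0_norm ?sqrtr_ge0//; apply: ler_wsqrtr; exact: HBE.
    by rewrite /c2 -mulrA; apply: ler_pM; rewrite ?normr_ge0 ?l2norm_ge0.
  + rewrite /truncation_mu -/t; have := dom_L2 symG (Dmu t tI).
    by have := op_L2 symL D2; move=> *; l2_closed.
  + by l2_closed.
  apply: filterS (emu t tI) => x /(_ I) + _.
  rewrite /truncation_mu -/t /beta /betab /sav_beta !pointwiseE => ->.
  by ring.
apply: (le_sum _ c3) => //; first lra.
have -> : truncation_r vol E1 U dt phi r (phibar dt n) n =
    ((2 * dt)^-1 * (3 * r t - 4 * r (t - dt) + r (t - 2 * dt)) - rt t) +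
    (inner (beta - betab) (phit t) - inner betab ((2 * dt)^-1 *: V - phit t)) / 2.
  have -> : rt t = inner beta (phit t) / 2.
    rewrite er// invfM /beta /sav_beta innerZl//.
    by rewrite [RHS]mulrC mulrA.
  have Ebar : (2 * Num.sqrt (E1 (phibar dt n)))^-1 *: U (phibar dt n) = 2^-1 *: betab.
    by rewrite invfM -scalerA.
  have VqL := L2Z (2 * dt)^-1 VL.
  rewrite /truncation_r tn tn1 -/t -/V Ebar innerZl// innerBl// innerBr// innerZr//.
  by field; rewrite gt_eqF.
have i1 := cauchy_schwarz (L2B bL bbL) F0.
have i2 : `|inner betab ((2 * dt)^-1 *: V - phit t)| <=
    l2norm betab * l2norm ((2 * dt)^-1 *: V - phit t).
  by apply: cauchy_schwarz; l2_closed.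
have j1 : `|inner (beta - betab) (phit t)| <= Bl * `|C| * P * dt ^+ 2.
  rewrite (le_trans i1)// mulrAC.
  by apply: ler_pM; [exact: l2norm_ge0|exact: l2norm_ge0|exact: dbeta|exact: HP].
have j2 : `|inner betab ((2 * dt)^-1 *: V - phit t)| <= Bb * c1 * dt ^+ 2.
  rewrite (le_trans i2)// -mulrA.
  by apply: ler_pM; [exact: l2norm_ge0|exact: l2norm_ge0|exact: HBb|exact: VB].
rewrite (le_trans (ler_normD _ _))// normrM (ger0_norm (_ : 0 <= 2^-1 :> R)) ?invr_ge0//.
have := ler_normB (inner (beta - betab) (phit t))
  (inner betab ((2 * dt)^-1 *: V - phit t)).
move: rB j1 j2; rewrite /c3.
set x := `|_ - rt t|; set y := `|inner _ _ - _|.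
set y1 := `|_|; set y2 := `|_| => rB j1 j2 yB.
have y0 : 0 <= y := normr_ge0 _.
by rewrite !mulrDl; lra.
Qed.

End Scheme.

Theorem theorem2p2 (R : realType) (d : measure_display)
    (Omega : measurableType d) (vol : {measure set Omega -> \bar R})
    (domG domL : set (Omega -> R))
    (G L : (Omega -> R) -> (Omega -> R))
    (E1 : (Omega -> R) -> R) (U : (Omega -> R) -> (Omega -> R)) (C0 : R)
    (symG : symmetric_operator vol domG G) (negG : nonpositive_on vol domG G)
    (symL : symmetric_operator vol domL L) (posL : nonnegative_on vol domL L)
    (C0_gt0 : 0 < C0) (E1_ge : forall v : Omega -> R, domL v -> C0 <= E1 v)
    (dE1 : variational_derivative vol domL E1 U) :
  (* second-order accuracy *)
  (forall (T : R) (phi phit mu : R -> Omega -> R) (r rt : R -> R)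
      (N : (Omega -> R) -> R) (phibar : R -> nat -> Omega -> R),
    0 < T ->
    sav_solution vol domG domL G L E1 U T phi phit mu r rt ->
    smooth_in_time vol T phit rt ->
    norm_over_l2 vol domL N ->
    lipschitz_on_bounded_sets vol domL U N ->
    (exists M : R, forall t : R, 0 <= t <= T -> N (phi t) <= M) ->
    second_order_approximation domL N T phi phibar ->
    second_order_accurate vol G L E1 U T phi mu r phibar) /\
  (* unconditional energy stability *)
  (forall (dt : R) (phibar phi0 phi1 : Omega -> R) (r0 r1 : R)
      (phi2 mu2 : Omega -> R) (r2 : R),
    0 < dt -> domL phibar -> domL phi0 -> domL phi1 ->
    sav_bdf_step vol domG domL G L E1 U dt phibar phi0 phi1 r0 r1 phi2 mu2 r2 ->
    dt^-1 * (modified_energy vol L phi2 r2 phi1 r1 -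
             modified_energy vol L phi1 r1 phi0 r0) +
    dt^-1 * (4%:R^-1 * inner vol (phi2 - 2%:R *: phi1 + phi0)
                                 (L (phi2 - 2%:R *: phi1 + phi0)) +
             2%:R^-1 * (r2 - 2%:R * r1 + r0) ^+ 2) =
    inner vol mu2 (G mu2)) /\
  (* the step amounts to two linear equations with constant coefficients *)
  (forall (dt : R) (phibar phi0 phi1 : Omega -> R) (r0 r1 : R)
      (xi1 xi2 : Omega -> R),
    0 < dt -> domL phibar -> domG (U phibar) -> domL phi0 -> domL phi1 ->
    solves_linear vol domG domL G L (sav_lambda dt)
      (sav_rhs vol G E1 U dt phibar phi0 phi1 r0 r1) xi1 ->
    solves_linear vol domG domL G L (sav_lambda dt)
      (G (sav_beta E1 U phibar)) xi2 ->
    let phi2 := sav_phi vol E1 U dt phibar xi1 xi2 in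
    let mu2 := sav_mu vol L E1 U dt phibar phi0 phi1 r0 r1 xi1 xi2 in
    let r2 := sav_r vol E1 U dt phibar phi0 phi1 r0 r1 xi1 xi2 in
    [/\ 1 - sav_lambda dt / 2%:R * inner vol (sav_beta E1 U phibar) xi2 != 0,
        sav_bdf_step vol domG domL G L E1 U dt phibar phi0 phi1 r0 r1 phi2 mu2 r2 &
        forall (phi mu : Omega -> R) (r : R),
          sav_bdf_step vol domG domL G L E1 U dt phibar phi0 phi1 r0 r1 phi mu r ->
          [/\ phi = phi2 %[ae vol], mu = mu2 %[ae vol] & r = r2]]).
Proof.
split=> [T phi phit mu r rt N phibar|].
  exact: (scheme_consistent symG symL C0_gt0 E1_ge dE1).
split=> [dt phibar phi0 phi1 r0 r1 phi2 mu2 r2|dt phibar phi0 phi1 r0 r1 xi1 xi2].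
  exact: (energy_law symG symL dE1).
exact: (sav_step_solution symG negG symL posL dE1).
Qed.
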